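(* Let $1<S\le N$, $L$ a band-width vector, $\dot W$ an $L$-admissible matrix, $W_\varepsilon=\mathrm{Id}+\varepsilon\dot W$, $k\in\mathbb N$, $\beta\in\Gamma$, $D_\beta=D_{k,\beta,L}$, $P_{\varepsilon,\beta}=D_\beta W_\varepsilon$ and $\hat P_\beta=D_\beta\hat W_L$. Let $\gamma>0$ be such that $P_{\varepsilon,\beta}$ has $N$ distinct eigenvalues for $0<\varepsilon<\gamma$, and for such $\varepsilon$ let $f^{(1)}_\varepsilon,\dots,f^{(N)}_\varepsilon$ be a unit-norm eigenbasis of $P_{\varepsilon,\beta}$ with eigenvalues $\lambda^{(1)}_\varepsilon,\dots,\lambda^{(N)}_\varepsilon$, labelled so that each $\varepsilon\mapsto\lambda^{(\ell)}_\varepsilon$ is continuous on $(0,\gamma)$ and $\lambda^{(\ell)}_\varepsilon\to e^{-2\pi ik\beta_s}$ as $\varepsilon\to0$ whenever $\ell\in B_s$. Then: (i) there exists an orthonormal eigenbasis $\{f^{(1)},\dots,f^{(N)}\}$ of $\hat P_\beta$ such that $[f^{(\ell)}_\varepsilon]\to[f^{(\ell)}]$ in $\mathbb{CP}^{N-1}$ as $\varepsilon\to0$, i.e. $\min_{\theta\in[0,2\pi)}\|f^{(\ell)}_\varepsilon-e^{i\theta}f^{(\ell)}\|\to0$, for every $\ell$; (ii) for $s\in\{1,\dots,S\}$ and $\ell\in B_s$, letting $\hat\lambda^{(\ell)}$ be the eigenvalue of $\hat P_\beta$ associated with $f^{(\ell)}$, we have $\lambda^{(\ell)}_\varepsilon=e^{-2\pi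 ik\beta_s}+\varepsilon\hat\lambda^{(\ell)}+o(\varepsilon)$ as $\varepsilon\to0$. Moreover, if $\hat\lambda^{(\ell)}\ne0$, then $\arg\hat\lambda^{(\ell)}=\arg\bigl(e^{-2\pi ik\beta_s}\bigr)+\pi$ (mod $2\pi$).
   Context: A band-width vector is $L=(L_1,\dots,L_S)$ of positive integers with $\sum_sL_s=N$; $N_0=0$, $N_s=N_{s-1}+L_s$, $B_s=\{j:N_{s-1}<j\le N_s\}$. $D_{k,\beta,L}$ is the diagonal matrix with $j$-th entry $e^{-2\pi ik\beta_s}$ for $j\in B_s$. $\dot W$ is $L$-admissible if it is real symmetric and (1) $\dot W_{ij}\ge0$ for $i\ne j$, $\sum_j\dot W_{ij}=0$ for all $i$; (2) $\dot W$ has $N$ distinct eigenvalues; (3) each $\hat W_s=(\dot W_{jk})_{j,k\in B_s}$ has $L_s$ distinct eigenvalues. $\hat W_L$ is block diagonal with blocks $\hat W_1,\dots,\hat W_S$. $\Gamma=\{\beta\in\mathbb R^S: e^{-2\pi ik\beta_{s_1}}\neq e^{-2\pi ik\beta_{s_2}}\text{ for all }k\ne0,\ s_1\ne s_2\}$. $\mathbb{CP}^{N-1}$ is the complex projective space, $[v]$ the class of $v\ne0$, with distance $\mathrm{dist}([v],[w])=\min_\theta\|v/\|v\|-e^{i\theta}w/\|w\|\|$. Norms and inner products are the standard ones on $\mathbb C^N$. *)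

(* Defs.v *)
From HB Require Import structures.
From mathcomp Require Import all_boot all_order all_algebra.
From mathcomp Require Import all_classical all_reals all_analysis.
From mathcomp Require Import complex.
Set Implicit Arguments.
Unset Strict Implicit.
Unset Printing Implicit Defensive.
Import Order.TTheory GRing.Theory Num.Theory.
Import numFieldNormedType.Exports.
Local Open Scope ring_scope.
Local Open Scope complex_scope.

Section Defs.
Variable R : realType.
Local Notation C := (R[i]).

Definition cmod (z : C) : R := let: a +i* b := z in Num.sqrt (a ^+ 2 + b ^+ 2).

Definition expi (t : R) : C := cos t +i* sin t.

Definition ephase (k : R) (b : R) : C := expi (- (2 * pi * k * b)).

(* N_{s-1} in the paper (0-based blocks s : 'I_S) *)
Definition Nstart (S : nat) (L : 'I_S -> nat) (s : 'I_S) : nat :=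
  (\sum_(t < S | (t < s)%N) L t)%N.

(* j \in B_s, with 0-based indices j : 'I_N and s : 'I_S *)
Definition inblock (S N : nat) (L : 'I_S -> nat) (s : 'I_S) (j : 'I_N) : bool :=
  (Nstart L s <= j < Nstart L s + L s)%N.

Definition bandwidth (S N : nat) (L : 'I_S -> nat) : Prop :=
  (forall s, (0 < L s)%N) /\ (\sum_(s < S) L s)%N = N.

Definition has_distinct_eigs (n : nat) (A : 'M[C]_n) : Prop :=
  exists e : 'I_n -> C, injective e /\ forall i, eigenvalue A (e i).

Definition Wblock (S N : nat) (L : 'I_S -> nat) (W : 'M[R]_N) (s : 'I_S)
  : 'M[C]_(L s) :=
  \matrix_(i < L s, j < L s)
    match @insub nat (fun m => (m < N)%N) 'I_N (Nstart L s + i)%N,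
          @insub nat (fun m => (m < N)%N) 'I_N (Nstart L s + j)%N with
    | Some a, Some b => (W a b)%:C
    | _, _ => 0
    end.

Definition admissible (S N : nat) (L : 'I_S -> nat) (W : 'M[R]_N) : Prop :=
  W^T = W /\
  (forall i j : 'I_N, i != j -> 0 <= W i j) /\
  (forall i : 'I_N, \sum_(j < N) W i j = 0) /\
  has_distinct_eigs (map_mx (fun x : R => x%:C) W) /\
  (forall s : 'I_S, has_distinct_eigs (Wblock L W s)).

Definition hatW (S N : nat) (L : 'I_S -> nat) (W : 'M[R]_N) : 'M[C]_N :=
  \matrix_(i, j) (if [exists s, inblock L s i && inblock L s j]
                  then (W i j)%:C else 0).

Definition inGamma (S : nat) (beta : 'I_S -> R) : Prop :=
  forall (k : int) (s1 s2 : 'I_S), k != 0 -> s1 != s2 ->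
    ephase k%:~R (beta s1) != ephase k%:~R (beta s2).

Definition Dmat (S N : nat) (L : 'I_S -> nat) (k : nat) (beta : 'I_S -> R)
  : 'M[C]_N :=
  \matrix_(i, j) (if i == j then \sum_(s < S | inblock L s i) ephase k%:R (beta s)
                  else 0).

Definition Weps (N : nat) (W : 'M[R]_N) (eps : R) : 'M[C]_N :=
  1%:M + (eps%:C) *: map_mx (fun x : R => x%:C) W.

Definition cdot (N : nat) (v w : 'cV[C]_N) : C := \sum_(i < N) (v i 0)^* * w i 0.
Definition vnorm (N : nat) (v : 'cV[C]_N) : R :=
  Num.sqrt (\sum_(i < N) cmod (v i 0) ^+ 2).

(* distance in CP^{N-1}: min over theta of || v/|v| - e^{i theta} w/|w| ||
   (the minimum is attained, so it equals the infimum) *)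
Definition cpdist (N : nat) (v w : 'cV[C]_N) : R :=
  inf [set r : R | exists theta : R, 0 <= theta < 2 * pi /\
        r = vnorm ((vnorm v)^-1%:C *: v - (expi theta * (vnorm w)^-1%:C) *: w)].

Definition is_arg (z : C) (theta : R) : Prop := z = (cmod z)%:C * expi theta.

End Defs.

(* Main.v *)
(** On the block [B_s], [D] is the scalar [om_s], and the [om_s] are distinct. Let [f] be a
    unit eigenvector of [D (1 + e W)] whose eigenvalue [lam] is close to [om_s]. Its entries
    outside [B_s] are [O(e)]. Pairing the eigenvalue equation with an orthonormal eigenbasis
    [g_a] of the block diagonal part of [W], with eigenvalues [w_a], then gives
    [(lam - om_s - e om_s w_a) <g_a, f> = O(e^2)] for all [a] in [B_s]. By pigeonhole some
    [|<g_a, f>|] is at least [1/N], so [lam = om_s + e om_s w_a + O(e^2)]; the other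
    coefficients of [f] are [O(e)] because the [w_a] of one block are distinct. Continuity of
    [lam] in [e] and the intermediate value theorem keep [a] constant as [e] tends to 0.

    Distinct labels [l] have distinct limits [a]: since [W] is symmetric, [D^-1 f] is a left
    eigenvector, so eigenvectors [f, f'] with different eigenvalues satisfy
    [f^T D^-1 f' = 0], whereas [g_a^T D^-1 g_a <> 0] because [g_a] is real up to a phase.

    Finally [w_a <= 0] since [- W] is a graph Laplacian, so [om_s w_a] is opposite to [om_s]. *)
Require Import Defs.
From HB Require Import structures.
From mathcomp Require Import all_boot all_order all_algebra.
From mathcomp Require Import all_classical all_reals all_analysis.
From mathcomp Require Import complex.
From mathcomp Require Import ring lra.
Import Order.TTheory GRing.Theory Num.Theory.
Import numFieldNormedType.Exports.
Local Open Scope ring_scope.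
Local Open Scope classical_set_scope.
Local Open Scope ring_scope.
Local Open Scope complex_scope.
(* [^*] must be read as [Num.conj], as it is inside the sum defining [cdot]. *)
Local Open Scope ring_scope.
Set Implicit Arguments.
Unset Strict Implicit.
Unset Printing Implicit Defensive.

(** * Modulus and phases of complex numbers *)

Section ComplexModulus.
Variable R : realType.
Implicit Types (x y z : R[i]) (t : R).

(** Bridge to the complex-valued norm, through which the general norm lemmas are transferred to the
    real-valued [cmod]. *)
Lemma normC_cmod z : `|z| = (cmod z)%:C.
Proof. by case: z. Qed.

Lemma cmodM x y : cmod (x * y) = cmod x * cmod y.
Proof. by apply: complexI; rewrite rmorphM /= -!normC_cmod normrM. Qed.

Lemma cmodD x y : cmod (x + y) <= cmod x + cmod y.
Proof. by rewrite -lecR rmorphD /= -!normC_cmod ler_normD. Qed.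

Lemma cmod_ge0 z : 0 <= cmod z.
Proof. by rewrite -ler0c -normC_cmod. Qed.

Lemma cmodN z : cmod (- z) = cmod z.
Proof. by apply: complexI; rewrite -!normC_cmod normrN. Qed.

Lemma cmodB x y : cmod (x - y) <= cmod x + cmod y.
Proof. by rewrite -(cmodN y); exact: cmodD. Qed.

Lemma cmod_distC x y : cmod (x - y) = cmod (y - x).
Proof. by rewrite -cmodN opprB. Qed.

Lemma cmodJ z : cmod z^* = cmod z.
Proof. by apply: complexI; rewrite -!normC_cmod norm_conjC. Qed.

Lemma cmod_eq0 z : (cmod z == 0) = (z == 0).
Proof. by rewrite -(inj_eq (@complexI R)) -normC_cmod normr_eq0. Qed.

Lemma cmod_gt0 z : (0 < cmod z) = (z != 0).
Proof. by rewrite lt_neqAle eq_sym cmod_eq0 cmod_ge0 andbT. Qed.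

Lemma cmod0 : cmod (0 : R[i]) = 0.
Proof. by apply/eqP; rewrite cmod_eq0. Qed.

Lemma cmodR t : cmod t%:C = `|t|.
Proof. by rewrite /cmod /= expr0n addr0 sqrtr_sqr. Qed.

Lemma conjC_real t : (t%:C)^* = t%:C.
Proof. by rewrite conj_Creal // complex_real. Qed.

Lemma cmod_sum (I : finType) (P : pred I) (F : I -> R[i]) :
  cmod (\sum_(i | P i) F i) <= \sum_(i | P i) cmod (F i).
Proof.
elim/big_rec2: _ => [|i y x _ le_xy]; first by rewrite cmod0.
by apply: le_trans (cmodD _ _) _; rewrite lerD2l.
Qed.

Lemma sqr_cmod z : (cmod z ^+ 2)%:C = z^* * z.
Proof. by rewrite rmorphXn /= -normC_cmod normCKC. Qed.

Lemma cmod_dist_dist x y : `|cmod x - cmod y| <= cmod (x - y).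
Proof.
rewrite ler_norml; have := cmodD (x - y) y; have := cmodD (y - x) x.
rewrite !subrK (cmod_distC y x) => h1 h2; apply/andP; split; lra.
Qed.

Lemma cmod_expi t : cmod (expi t) = 1.
Proof. by rewrite /cmod /expi cos2Dsin2 sqrtr1. Qed.

Lemma expiD s t : expi (s + t) = expi s * expi t.
Proof.
apply/eqP; rewrite eq_complex /= cosD sinD.
by apply/andP; split; apply/eqP; ring.
Qed.

(** The angle is [acos a] in the upper half plane and its reflection [2 * pi - acos a] in the lower
    one. *)
Lemma expi_onto z : cmod z = 1 -> exists2 t, 0 <= t < 2 * pi & z = expi t.
Proof.
case: z => a b /= ab1.
have {}ab1 : a ^+ 2 + b ^+ 2 = 1.
  have h : 0 <= a ^+ 2 + b ^+ 2 by rewrite addr_ge0 ?sqr_ge0.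
  by rewrite -(sqr_sqrtr h) ab1 expr1n.
have a1 : -1 <= a <= 1.
  by apply/andP; split; have := sqr_ge0 b; nra.
have pi0 := pi_gt0 R.
have sinE : Num.sqrt (1 - a ^+ 2) = `|b| by rewrite -ab1 addrC addKr sqrtr_sqr.
have [b0|b0] := leP 0 b.
  exists (acos a); first by rewrite acos_ge0 //=; have := acos_lepi a1; lra.
  by rewrite /expi acosK // sin_acos // sinE ger0_norm.
exists (2 * pi - acos a).
  apply/andP; split; first by have := acos_lepi a1; lra.
  (* Here [b < 0] forces [a < 1], which keeps the angle strictly below [2 * pi]. *)
  have : 0 < acos a; last by lra.
  apply: acos_gt0; case/andP: a1 => -> a1 /=; rewrite lt_neqAle a1 andbT.
  apply/eqP => a_eq; move: ab1; rewrite a_eq; nra.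
have -> : 2 * pi - acos a = - acos a + pi *+ 2 by rewrite mulr_natl addrC.
rewrite /expi cosD2pi sinD2pi cosN sinN acosK // sin_acos // sinE.
by rewrite ltr0_norm // opprK.
Qed.

(** Reduce [t] modulo [2 * pi] to [u], then use injectivity of [cos] on [[0, pi]], after reflecting
    [u] if it exceeds [pi]. *)
Lemma expi_eq1 t : expi t = 1 -> exists m : int, t = 2 * pi * m%:~R.
Proof.
have pi0 := pi_gt0 R; have p2 : 0 < 2 * pi :> R by lra.
pose m := Num.floor (t / (2 * pi)).
move=> t1; exists m.
pose u := t - 2 * pi * m%:~R.
have u0 : 0 <= u < 2 * pi.
  have := floor_itv (t / (2 * pi)); rewrite -/m ler_pdivlMr // ltr_pdivrMr //.
  rewrite intrD /u => /andP[h1 h2]; apply/andP; split; lra.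
have expm (n : nat) : expi (2 * pi * n%:R) = 1 :> R[i].
  rewrite /expi mulr_natl; elim: n => [|n IHn]; first by rewrite mulr0 cos0 sin0.
  by rewrite -natr1 mulrDr mulr1 cosD2pi sinD2pi.
have expmZ (n : int) : expi (2 * pi * n%:~R) = 1 :> R[i].
  case: n => n; first exact: expm.
  rewrite NegzE intrN mulrN.
  by have := expm n.+1; rewrite /expi cosN sinN => -[-> ->]; rewrite oppr0.
have u1 : expi u = 1.
  have : expi (u + 2 * pi * m%:~R) = 1 by rewrite /u subrK.
  by rewrite expiD expmZ mulr1.
suff : u = 0 by move/eqP; rewrite subr_eq0 => /eqP.
move: u1; rewrite /expi => -[c1 s0].
have [up|up] := leP u pi.
  by apply: (@cos_inj R); rewrite ?in_itv /= ?cos0 ?lexx //; lra.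
suff : 2 * pi - u = 0 by move=> h; have := u0; lra.
apply: (@cos_inj R); rewrite ?in_itv /= ?cos0 ?lexx //; [lra|lra|].
have -> : 2 * pi - u = - u + pi *+ 2 by rewrite mulr_natl addrC.
by rewrite cosD2pi cosN.
Qed.

End ComplexModulus.

(** * The partition into blocks and the eigenvectors of the diagonal blocks *)

Section Blocks.
Variables (S N : nat) (L : 'I_S -> nat).
Hypothesis Lsum : (\sum_(s < S) L s)%N = N.

Lemma Nstart_addE s : (Nstart L s + L s)%N = (\sum_(t < S | (t <= s)%N) L t)%N.
Proof.
rewrite [RHS](bigD1 s) //= addnC; congr (_ + _)%N.
by apply: eq_bigl => t; rewrite ltn_neqAle andbC.
Qed.

Lemma Nstart_add_le s : (Nstart L s + L s <= N)%N.
Proof.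
rewrite Nstart_addE -Lsum [leqRHS](bigID (fun t : 'I_S => (t <= s)%N)) /=.
exact: leq_addr.
Qed.

Lemma Nstart_lt (s t : 'I_S) : (s < t)%N -> (Nstart L s + L s <= Nstart L t)%N.
Proof.
move=> st; rewrite Nstart_addE /Nstart.
rewrite [leqRHS](bigID (fun u : 'I_S => (u <= s)%N)) /=.
apply: leq_trans (leq_addr _ _); apply: eq_leq; apply: eq_bigl => u.
by case: (leqP u s) => us; rewrite ?andbF // andbT (leq_ltn_trans us st).
Qed.

(** The last block that starts at or before [i] contains [i], and the blocks are disjoint intervals.
    The function [blk] replaces [inblock] in all that follows. *)
Lemma block_indexP :
  exists blk : 'I_N -> 'I_S, forall s i, inblock L s i = (blk i == s).
Proof.
suff /choice [blk blkP] : forall i : 'I_N, exists s, inblock L s i.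
  exists blk => s i; apply/idP/eqP => [si|<-//].
  have /andP[si1 si2] := si; have /andP[bi1 bi2] := blkP i.
  case: (ltngtP (blk i) s) => [/Nstart_lt lt|/Nstart_lt lt|/val_inj //].
    by have := leq_trans bi2 (leq_trans lt si1); rewrite ltnn.
  by have := leq_trans si2 (leq_trans lt bi1); rewrite ltnn.
move=> i; have iN := ltn_ord i.
have S0 : (0 < S)%N.
  rewrite lt0n; apply/eqP => S0; have /= N0 := Lsum.
  rewrite big1 in N0; first by have := leq_ltn_trans (leq0n i) iN; rewrite -[X in (_ < X)%N]N0.
  by move=> s _; have := ltn_ord s; rewrite {2}S0.
have P0 : (Nstart L (Ordinal S0) <= i)%N by rewrite /Nstart big_pred0.
case: (@arg_maxnP _ _ (fun s => Nstart L s <= i)%N (fun s : 'I_S => s : nat) P0) => s sP smax.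
exists s; rewrite /inblock sP /= ltnNge; apply/negP => le.
(* If no block follows [s], then [s] ends at [N]; otherwise the next block would contradict
   maximality. *)
have [sS|sS] := ltnP s.+1 S; last first.
  suff sN : (Nstart L s + L s)%N = N by move: le; rewrite sN leqNgt iN.
  rewrite Nstart_addE -[RHS]Lsum; apply: eq_bigl => t.
  by rewrite -ltnS (leq_trans (ltn_ord t) sS).
suff /smax : (Nstart L (Ordinal sS) <= i)%N by rewrite /= ltnn.
by move: le; rewrite Nstart_addE.
Qed.

Variable R : realType.
Variable W : 'M[R]_N.
Variable blk : 'I_N -> 'I_S.
Hypothesis blkE : forall s i, inblock L s i = (blk i == s).

(** Each index [a] receives the eigenvalue of its block numbered by the position of [a] there; the
    eigenvector is moved into place by a shift and extended by zero. *)
Lemma block_eigenvectors :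
  (forall s, has_distinct_eigs (Wblock L W s)) ->
  exists (g : 'I_N -> 'I_N -> R[i]) (w : 'I_N -> R[i]),
  [/\ forall a i, blk i != blk a -> g a i = 0,
      forall a, exists i, g a i != 0,
      forall a i, blk i = blk a ->
        \sum_(j | blk j == blk a) g a j * (W j i)%:C = w a * g a i
    & forall a b, blk a = blk b -> w a = w b -> a = b].
Proof.
move=> eigs; pose e s := sval (cid (eigs s)).
have eP s : injective (e s) /\ forall x, eigenvalue (Wblock L W s) (e s x).
  by rewrite /e; case: cid.
have posP (a : 'I_N) : (Nstart L (blk a) <= a < Nstart L (blk a) + L (blk a))%N.
  by have := blkE (blk a) a; rewrite eqxx.
(* A plain natural number as position avoids transport between the types ['I_(L s)]; the default 0
   is never reached, by [pos_lt]. *)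
pose w' s (n : nat) := if insub n is Some x then e s x else 0.
pose w (a : 'I_N) := w' (blk a) (a - Nstart L (blk a))%N.
have pos_lt (a : 'I_N) : (a - Nstart L (blk a) < L (blk a))%N.
  by have /andP[? ?] := posP a; rewrite ltn_subLR.
suff /choice [g gP] : forall a, exists G : 'I_N -> R[i],
  [/\ forall i, blk i != blk a -> G i = 0, exists i, G i != 0 &
      forall i, blk i = blk a ->
        \sum_(j | blk j == blk a) G j * (W j i)%:C = w a * G i].
  exists g, w; split=> [a|a|a|a b ab]; try by case: (gP a).
  have := pos_lt b; have := pos_lt a; rewrite /w ab /w' => la lb.
  rewrite !insubT => /(eP _).1 [] /eqP; rewrite eqn_sub2rE; last 2 first.
  - by rewrite -ab; case/andP: (posP a).
  - by case/andP: (posP b).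
  by move=> /eqP/val_inj.
move=> a; set s := blk a; have x0 : 'I_(L s) := Ordinal (pos_lt a).
have hP (y : 'I_(L s)) : (Nstart L s + y < N)%N.
  by apply: leq_trans (Nstart_add_le s); rewrite ltn_add2l.
(* [h] and [k] are mutually inverse shifts; the default [x0] is only taken outside the block. *)
pose h (y : 'I_(L s)) := Ordinal (hP y).
pose k (j : 'I_N) : 'I_(L s) := insubd x0 (j - Nstart L s)%N.
have blkh y : blk (h y) == s.
  by rewrite -blkE /inblock /= leq_addr ltn_add2l ltn_ord.
have kh y : k (h y) = y.
  by apply: val_inj; rewrite val_insubd /= addKn ltn_ord.
have hk j : blk j == s -> h (k j) = j.
  move=> /eqP js; have := pos_lt j; have /andP[jS _] := posP j.
  rewrite js in jS * => jlt; apply: val_inj.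
  by rewrite /= val_insubd jlt subnKC.
have -> : w a = e s (Ordinal (pos_lt a)).
  by rewrite /w /w' (insubT (fun n => n < L (blk a))%N (pos_lt a)).
(* This is a left eigenvector, whence the factor [W j i] in the conclusion. *)
have /eigenvalueP[v vW v0] := (eP s).2 (Ordinal (pos_lt a)).
have /rV0Pn[y vy] := v0.
exists (fun i => if blk i == s then v 0 (k i) else 0); split.
- by move=> i /negPf ->.
- by exists (h y); rewrite blkh kh.
move=> i /eqP iS; rewrite iS; have /rowP/(_ (k i)) := vW; rewrite !mxE => <-.
rewrite (reindex_onto h k) /=; last by move=> j; exact: hk.
apply: eq_big => z; first by rewrite blkh kh eqxx.
rewrite blkh kh eqxx => _; congr (_ * _); rewrite mxE.
rewrite (insubT (fun m => m < N)%N (hP z)) (insubT (fun m => m < N)%N (hP (k i))).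
by rewrite -[in LHS](hk i) ?iS.
Qed.

End Blocks.

(** * Spectral theory of the block diagonal part of [W] *)

Section BlockSpectrum.
Variables (R : realType) (S N : nat) (W : 'M[R]_N) (blk : 'I_N -> 'I_S).
Local Notation C := R[i].
Implicit Types (s : 'I_S) (mu nu : C) (x y : 'I_N -> C).

(** An eigenvector of one diagonal block, not of [W]: rows outside the block are unconstrained. The
    zero vector is allowed, so scaling by any number preserves the predicate. *)
Definition block_eigvec s mu x : Prop :=
  (forall i, blk i != s -> x i = 0) /\
  (forall i, blk i = s ->
     \sum_(j | blk j == s) (W i j)%:C * x j = mu * x i).

Lemma sum_supp s x (F : 'I_N -> C) :
  (forall i, blk i != s -> x i = 0) ->
  \sum_i x i * F i = \sum_(i | blk i == s) x i * F i.
Proof.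
move=> x0; rewrite [LHS](bigID (fun i => blk i == s)) /=.
by rewrite [X in _ + X]big1 ?addr0 // => i /x0 ->; rewrite mul0r.
Qed.

(** With both vectors supported in the block, the full matrix [W] acts in the form as its diagonal
    block. *)
Lemma block_eigvec_form s mu x y :
  (forall i, blk i != s -> x i = 0) -> block_eigvec s mu y ->
  \sum_i \sum_j x i * (W i j)%:C * y j = mu * \sum_i x i * y i.
Proof.
move=> x0 [y0 yE]; rewrite mulr_sumr.
under eq_bigr => i _ do under eq_bigr do rewrite -mulrA.
under eq_bigr => i _ do rewrite -mulr_sumr.
under [RHS]eq_bigr do rewrite mulrCA.
rewrite !(sum_supp _ x0); apply: eq_bigr => i /eqP/yE <-; congr (_ * _).
under eq_bigr do rewrite mulrC.
by rewrite (sum_supp _ y0); under eq_bigr do rewrite mulrC.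
Qed.

Hypothesis Wsym : W^T = W.

Lemma sym_entryC i j : W i j = W j i.
Proof. by rewrite -{1}Wsym mxE. Qed.

(** By symmetry the form of [W] at [x, y] equals both [mu] and [nu] times the pairing. The pairing
    is bilinear; [block_eigvecJ] gives the Hermitian version. *)
Lemma block_eigvec_orth s mu nu x y :
  block_eigvec s mu x -> block_eigvec s nu y -> mu != nu ->
  \sum_i x i * y i = 0.
Proof.
move=> xE yE ne; apply/eqP.
have: mu * \sum_i x i * y i = nu * \sum_i x i * y i.
  rewrite -(block_eigvec_form xE.1 yE).
  under [X in mu * X]eq_bigr do rewrite mulrC.
  rewrite -(block_eigvec_form yE.1 xE) exchange_big /=.
  apply: eq_bigr => i _; apply: eq_bigr => j _.
  by rewrite mulrAC [RHS]mulrAC (sym_entryC i j) (mulrC (x i)).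
move/eqP; rewrite -subr_eq0 -mulrBl mulf_eq0 subr_eq0 (negPf ne); exact.
Qed.

Lemma block_eigvecJ s mu x : mu^* = mu ->
  block_eigvec s mu x -> block_eigvec s mu (fun i => (x i)^*).
Proof.
move=> muR [x0 xE]; split=> i si; first by rewrite x0 ?rmorph0.
rewrite -{1}muR -rmorphM /= -(xE i si) rmorph_sum; apply: eq_bigr => j _.
by rewrite rmorphM /= conjC_real.
Qed.

Lemma block_eigvecZ s mu x c :
  block_eigvec s mu x -> block_eigvec s mu (fun i => c * x i).
Proof.
move=> [x0 xE]; split=> i si; first by rewrite x0 ?mulr0.
rewrite mulrCA -(xE i si) mulr_sumr; apply: eq_bigr => j _.
by rewrite mulrCA.
Qed.

Hypothesis W_ge0 : forall i j : 'I_N, i != j -> 0 <= W i j.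
Hypothesis W_row : forall i : 'I_N, \sum_(j < N) W i j = 0.

(* [2 x^* W x = - sum_(i,j) W_ij |x_i - x_j|^2] because the rows of [W] sum to zero. *)
Lemma laplacian_form_le0 x :
  \sum_i \sum_j (x i)^* * (W i j)%:C * x j <= 0.
Proof.
set Q := \sum_i _.
have row0 (F : 'I_N -> C) : \sum_i \sum_j (W i j)%:C * F i = 0.
  rewrite big1 // => i _; rewrite -mulr_suml -rmorph_sum W_row.
  by rewrite rmorph0 mul0r.
have col0 (F : 'I_N -> C) : \sum_i \sum_j (W i j)%:C * F j = 0.
  rewrite exchange_big /= -[RHS](row0 F); apply: eq_bigr => i _.
  by apply: eq_bigr => j _; rewrite sym_entryC.
have QT : Q = \sum_i \sum_j (x j)^* * (W i j)%:C * x i.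
  rewrite /Q exchange_big; apply: eq_bigr => i _; apply: eq_bigr => j _.
  by rewrite sym_entryC.
have QE : \sum_i \sum_j (W i j)%:C * ((x i - x j)^* * (x i - x j)) = - (Q *+ 2).
  pose F i := (x i)^* * x i.
  transitivity (\sum_i \sum_j ((W i j)%:C * F i + (W i j)%:C * F j
    - (x i)^* * (W i j)%:C * x j - (x j)^* * (W i j)%:C * x i)).
    apply: eq_bigr => i _; apply: eq_bigr => j _; rewrite rmorphB /= /F; ring.
  under eq_bigr do rewrite !big_split /= !sumrN.
  rewrite !big_split /= !sumrN row0 col0 -QT -/Q mulr2n opprD !add0r; ring.
suff : 0 <= - (Q *+ 2) by rewrite oppr_ge0 pmulrn_lle0.
rewrite -QE; apply: sumr_ge0 => i _; apply: sumr_ge0 => j _.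
have [->|ij] := eqVneq i j; first by rewrite subrr mulr0 mulr0.
by rewrite mulr_ge0 ?ler0c ?W_ge0 // mulrC mul_conjC_ge0.
Qed.

(** The rows of a single block need not sum to zero, so the form of the whole [W] is used: at [x] it
    is [mu] times the squared norm. In the order of [C], the conclusion also says that [mu] is
    real. *)
Lemma block_eigval_le0 s mu x :
  block_eigvec s mu x -> (exists i, x i != 0) -> mu <= 0.
Proof.
move=> xE [i xi].
have x0J : forall j, blk j != s -> (x j)^* = 0 by move=> j /xE.1 ->; rewrite rmorph0.
have := laplacian_form_le0 x; rewrite (block_eigvec_form x0J xE) pmulr_lle0 //.
have ge0 j : 0 <= (x j)^* * x j by rewrite mulrC mul_conjC_ge0.
rewrite (bigD1 i) //=; apply: ltr_pwDl; last by apply: sumr_ge0 => j _; exact: ge0.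
by rewrite lt_neqAle ge0 andbT eq_sym mulf_neq0 // conjC_eq0.
Qed.

(** Normalise the given eigenvectors. Orthogonality comes from disjoint supports across blocks and
    from distinct real eigenvalues within a block. *)
Lemma block_eigenbasis (g0 : 'I_N -> 'I_N -> C) (w0 : 'I_N -> C) :
  (forall a, block_eigvec (blk a) (w0 a) (g0 a)) ->
  (forall a, exists i, g0 a i != 0) ->
  (forall a b, blk a = blk b -> w0 a = w0 b -> a = b) ->
  exists (g : 'I_N -> 'I_N -> C) (w : 'I_N -> R),
  [/\ forall a, block_eigvec (blk a) (w a)%:C (g a),
      forall a, w a <= 0,
      forall a b, blk a = blk b -> w a = w b -> a = b &
      [/\ forall a b, \sum_i (g a i)^* * g b i = (a == b)%:R,
          forall i j, \sum_a g a i * (g a j)^* = (i == j)%:R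
        & forall a, \sum_i g a i * g a i != 0]].
Proof.
move=> g0E g0n w0inj.
have w0le a : w0 a <= 0 by apply: block_eigval_le0 (g0E a) (g0n a).
pose w a := complex.Re (w0 a).
have wE a : (w a)%:C = w0 a.
  by rewrite /w RRe_real // realE w0le orbT.
pose n a : R := Num.sqrt (\sum_i cmod (g0 a i) ^+ 2).
have sn0 a : 0 < \sum_i cmod (g0 a i) ^+ 2.
  have [i gi] := g0n a; rewrite (bigD1 i) //=; apply: ltr_pwDl.
    by rewrite exprn_gt0 // cmod_gt0.
  by apply: sumr_ge0 => j _; rewrite exprn_ge0 ?cmod_ge0.
have n0 a : n a != 0 by rewrite gt_eqF // sqrtr_gt0.
pose g a i := ((n a)^-1)%:C * g0 a i.
have gE a : block_eigvec (blk a) (w a)%:C (g a).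
  by rewrite wE; apply: block_eigvecZ.
have winj a b : blk a = blk b -> w a = w b -> a = b.
  by move=> ab e; apply: w0inj => //; rewrite -!wE e.
have gJ a : block_eigvec (blk a) (w a)%:C (fun i => (g a i)^*).
  by apply: block_eigvecJ => //; rewrite conjC_real.
have gdot a b : \sum_i (g a i)^* * g b i = (a == b)%:R.
  have [->|ab] := eqVneq a b.
    under eq_bigr do rewrite -sqr_cmod cmodM cmodR exprMn.
    rewrite -rmorph_sum /= -mulr_sumr real_normK ?num_real // exprVn.
    by rewrite sqr_sqrtr ?ltW // mulVf ?gt_eqF.
  have [bab|bab] := eqVneq (blk a) (blk b); last first.
    rewrite big1 // => i _; have [ia|ia] := eqVneq (blk i) (blk a).
      by rewrite ((gE b).1 i) ?mulr0 // ia.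
    by rewrite ((gE a).1 i) ?rmorph0 ?mul0r.
  have gEb := gE b; rewrite -bab in gEb.
  apply: block_eigvec_orth (gJ a) gEb _.
  by apply: contra ab => /eqP/complexI/(winj _ _ bab)/eqP.
have gcomp i j : \sum_a g a i * (g a j)^* = (i == j)%:R.
  pose G := \matrix_(a < N, j < N) g a j.
  pose G' := \matrix_(j < N, a < N) (g a j)^*.
  (* A one-sided inverse of a square matrix is two-sided, so orthonormality yields completeness. *)
  have : G *m G' = 1%:M.
    apply/matrixP => a b; rewrite !mxE eq_sym -gdot; apply: eq_bigr => k _.
    by rewrite !mxE mulrC.
  move/mulmx1C/matrixP/(_ j i); rewrite !mxE eq_sym => <-.
  by apply: eq_bigr => a _; rewrite !mxE mulrC.
exists g, w; split=> //.
  by move=> a; rewrite -(@lecR R) wE.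
split=> // a; apply/eqP => gg0.
(* If the bilinear square of [g a] vanished, the conjugate of [g a] would have zero coefficient on
   every basis vector, hence be zero. *)
have gJ0 i : (g a i)^* = 0.
  have -> : (g a i)^* = \sum_j (i == j)%:R * (g a j)^*.
    rewrite (bigD1 i) //= eqxx mul1r big1 ?addr0 // => j.
    by rewrite eq_sym => /negPf ->; rewrite mul0r.
  under eq_bigr do rewrite -gcomp mulr_suml.
  rewrite exchange_big big1 // => b _ /=.
  under eq_bigr do rewrite -mulrA; rewrite -mulr_sumr.
  suff -> : \sum_j (g b j)^* * (g a j)^* = 0 by rewrite mulr0.
  have [->|ab] := eqVneq b a.
    under eq_bigr do rewrite -rmorphM; rewrite -rmorph_sum.
    by rewrite gg0 rmorph0.
  have [bab|bab] := eqVneq (blk b) (blk a); last first.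
    rewrite big1 // => j _; have [jb|jb] := eqVneq (blk j) (blk b).
      by rewrite ((gJ a).1 j) ?mulr0 // jb.
    by rewrite ((gJ b).1 j) ?mul0r.
  have gJb := gJ b; rewrite bab in gJb.
  apply: block_eigvec_orth gJb (gJ a) _.
  by apply: contra ab => /eqP/complexI/(winj _ _ bab)/eqP.
have := gdot a a; rewrite eqxx big1 => [/eqP|i _].
  by rewrite eq_sym oner_eq0.
by rewrite gJ0 mul0r.
Qed.

End BlockSpectrum.

(** Supplies uniform gaps between phases and between eigenvalues of a block; the 1 in the minimum
    covers an empty range. *)
Lemma finite_lower_bound (R : realType) (I : finType) (P : pred I) (F : I -> R) :
  (forall i, P i -> 0 < F i) -> exists2 m, 0 < m & forall i, P i -> m <= F i.
Proof.
move=> F0; exists (\big[Num.min/1]_(i | P i) F i); first exact: lt_bigmin.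
by move=> i Pi; exact: bigmin_le_cond.
Qed.

(** * Quantitative perturbation estimates at a fixed [e] *)

Section Perturbation.
Variables (R : realType) (S N : nat) (W : 'M[R]_N) (blk : 'I_N -> 'I_S).
Local Notation C := R[i].
Variables (om : 'I_S -> C) (g : 'I_N -> 'I_N -> C) (w : 'I_N -> R).
Hypothesis Wsym : W^T = W.
Hypothesis om1 : forall s, cmod (om s) = 1.
Hypothesis gE : forall a, block_eigvec W blk (blk a) (w a)%:C (g a).
Hypothesis winj : forall a b, blk a = blk b -> w a = w b -> a = b.
Hypothesis gdot : forall a b, \sum_i (g a i)^* * g b i = (a == b)%:R.
Hypothesis gcomp : forall i j, \sum_a g a i * (g a j)^* = (i == j)%:R.

Definition coef (x : 'I_N -> C) (a : 'I_N) : C := \sum_i (g a i)^* * x i.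

Lemma coef_expand x i : x i = \sum_a coef x a * g a i.
Proof.
under eq_bigr do rewrite /coef mulr_suml.
rewrite exchange_big /= [LHS](_ : _ = \sum_j (i == j)%:R * x j).
  apply: eq_bigr => j _; rewrite -gcomp mulr_suml; apply: eq_bigr => a _; ring.
rewrite (bigD1 i) //= eqxx mul1r big1 ?addr0 // => j.
by rewrite eq_sym => /negPf ->; rewrite mul0r.
Qed.

Lemma coef_parseval x : \sum_a cmod (coef x a) ^+ 2 = \sum_i cmod (x i) ^+ 2.
Proof.
apply: complexI; rewrite !rmorph_sum /=.
under eq_bigr do rewrite sqr_cmod {2}/coef mulr_sumr.
rewrite exchange_big /=; apply: eq_bigr => i _; rewrite sqr_cmod.
rewrite [in X in X^* * _](coef_expand x i) rmorph_sum mulr_suml.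
by apply: eq_bigr => a _; rewrite rmorphM /= mulrA.
Qed.

Lemma unit_entry_le1 (x : 'I_N -> C) i :
  \sum_i cmod (x i) ^+ 2 = 1 -> cmod (x i) <= 1.
Proof.
move=> x1; rewrite -(@expr_le1 _ 2) ?cmod_ge0 // -x1 (bigD1 i) //= lerDl.
by apply: sumr_ge0 => j _; rewrite exprn_ge0 ?cmod_ge0.
Qed.

Lemma basis_entry_le1 a i : cmod (g a i) <= 1.
Proof.
apply: unit_entry_le1; apply: complexI; rewrite rmorph_sum /=.
by under eq_bigr do rewrite sqr_cmod; rewrite gdot eqxx.
Qed.

(** The entrywise l1 norm of [W], a crude bound for all sums below since unit vectors have entries
    of modulus at most 1. *)
Let M := \sum_i \sum_j `|W i j|.

Let M_ge0 : 0 <= M.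
Proof. by apply: sumr_ge0 => i _; apply: sumr_ge0 => j _. Qed.

Section EigenEquation.
Variables (s : 'I_S) (d e : R) (lam : C) (x : 'I_N -> C).
Hypothesis d0 : 0 < d.
Hypothesis e0 : 0 < e.
Hypothesis sep_om : forall t, t != s -> d <= cmod (om t - lam).
Hypothesis x1 : \sum_i cmod (x i) ^+ 2 = 1.
Hypothesis xE : forall i,
  om (blk i) * (x i + e%:C * \sum_j (W i j)%:C * x j) = lam * x i.

(** Row [i] reads [(om_t - lam) x_i = - e om_t (W x)_i] with [t = blk i]; divide by the left factor,
    of modulus at least [d]. *)
Lemma off_block_entry i : blk i != s -> cmod (x i) <= e * (M / d).
Proof.
move=> is_; rewrite mulrA ler_pdivlMr // mulrC.
apply: le_trans (ler_wpM2r (cmod_ge0 _) (sep_om is_)) _; rewrite -cmodM.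
have -> : (om (blk i) - lam) * x i
    = - (e%:C * (om (blk i) * \sum_j (W i j)%:C * x j)).
  by rewrite mulrBl -xE; ring.
rewrite cmodN !cmodM om1 mul1r cmodR gtr0_norm // ler_pM2l //.
apply: le_trans (cmod_sum _ _) _; rewrite /M [leRHS](bigD1 i) //=.
apply: (@le_trans _ _ (\sum_j `|W i j|)).
  by apply: ler_sum => j _; rewrite cmodM cmodR ler_piMr // unit_entry_le1.
by rewrite lerDl; apply: sumr_ge0 => k _; apply: sumr_ge0.
Qed.

Lemma off_block_coef a : blk a != s -> cmod (coef x a) <= e * (N%:R * (M / d)).
Proof.
move=> as_; apply: le_trans (cmod_sum _ _) _.
have -> : e * (N%:R * (M / d)) = \sum_(i < N) (e * (M / d)).
  by rewrite sumr_const card_ord -[RHS]mulr_natl mulrCA.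
apply: ler_sum => i _; rewrite cmodM.
have K0 : 0 <= e * (M / d) by rewrite mulr_ge0 ?(ltW e0) // divr_ge0 // ltW.
have [ia|ia] := eqVneq (blk i) (blk a); last first.
  by rewrite ((gE a).1 i ia) rmorph0 cmod0 mul0r.
rewrite cmodJ; apply: le_trans (ler_wpM2r (cmod_ge0 _) (basis_entry_le1 a i)) _.
by rewrite mul1r off_block_entry // ia.
Qed.

(** Split [x] into its part [y] in the block and the rest [z]. Pairing the equation with [g a], the
    term in [y] gives the shift [e om_s w_a]; the term in [z] carries a second factor [e] by
    [off_block_entry]. *)
Lemma in_block_coef a : blk a = s ->
  cmod (lam - om s - e%:C * (om s * (w a)%:C)) * cmod (coef x a)
    <= e ^+ 2 * (M * (M / d)).
Proof.
move=> as_; rewrite -cmodM.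
pose y i := if blk i == s then x i else 0.
pose z i := if blk i == s then 0 else x i.
have xyz i : x i = y i + z i by rewrite /y /z; case: ifP; rewrite ?addr0 ?add0r.
have g0 i : blk i != s -> (g a i)^* = 0.
  by move=> is_; rewrite ((gE a).1 i) ?rmorph0 // as_.
have gJ : block_eigvec W blk s (w a)%:C (fun i => (g a i)^*).
  by rewrite -as_; apply: block_eigvecJ (gE a); rewrite conjC_real.
have y0 i : blk i != s -> y i = 0 by rewrite /y => /negPf ->.
have coefy : coef x a = \sum_i y i * (g a i)^*.
  apply: eq_bigr => i _; rewrite /y mulrC; case: ifP => // /negbT is_.
  by rewrite (g0 i is_) mulr0 mul0r.
have formy : (w a)%:C * coef x a = \sum_i \sum_j (g a i)^* * (W i j)%:C * y j.
  rewrite coefy -(block_eigvec_form y0 gJ) exchange_big.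
  apply: eq_bigr => i _; apply: eq_bigr => j _.
  by rewrite (sym_entryC Wsym i j) mulrAC [RHS]mulrAC (mulrC (y j)).
have key : (lam - om s - e%:C * (om s * (w a)%:C)) * coef x a
    = e%:C * (om s * \sum_i \sum_j (g a i)^* * (W i j)%:C * z j).
  rewrite mulrBl -!(mulrA e%:C) -(mulrA (om s)) formy.
  rewrite {1}/coef mulr_sumr.
  have -> : \sum_i (lam - om s) * ((g a i)^* * x i)
      = e%:C * (om s * \sum_i \sum_j (g a i)^* * (W i j)%:C * x j).
    rewrite !mulr_sumr; apply: eq_bigr => i _.
    have [is_|is_] := eqVneq (blk i) s; last first.
      rewrite (g0 i is_) mul0r mulr0 big1 ?mulr0 // => j _.
      by rewrite !mul0r.
    under eq_bigr do rewrite -mulrA.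
    rewrite -mulr_sumr; have := xE i; rewrite is_; set T := \sum_j _ => h.
    rewrite mulrBl [lam * _]mulrCA -h; ring.
  rewrite -!mulrBr -sumrB; congr (_ * (_ * _)); apply: eq_bigr => i _.
  by rewrite -sumrB; apply: eq_bigr => j _; rewrite (xyz j); ring.
rewrite key !cmodM om1 mul1r cmodR gtr0_norm // expr2 -mulrA ler_pM2l //.
rewrite mulrCA; apply: le_trans (cmod_sum _ _) _; rewrite mulr_suml.
apply: ler_sum => i _; apply: le_trans (cmod_sum _ _) _; rewrite mulr_suml.
apply: ler_sum => j _; rewrite !cmodM cmodR cmodJ.
have K0 : 0 <= e * (M / d) by rewrite mulr_ge0 ?(ltW e0) // divr_ge0 // ltW.
apply: ler_pM; rewrite ?mulr_ge0 ?cmod_ge0 //.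
  by rewrite ler_piMl // basis_entry_le1.
by rewrite /z; case: ifPn => js; [rewrite cmod0 | rewrite off_block_entry].
Qed.

End EigenEquation.

(* Pigeonhole in Parseval's identity. *)
Lemma large_coef x : \sum_i cmod (x i) ^+ 2 = 1 ->
  exists a, N%:R^-1 <= cmod (coef x a).
Proof.
move=> x1; have [/existsP[a aP]|] := boolP [exists a, N%:R^-1 <= cmod (coef x a)].
  by exists a.
rewrite negb_exists => /forallP small.
have N0 : (0 < N)%N.
  by rewrite lt0n; apply/eqP => N0; move: x1; rewrite big1 => [/eqP|[i iN]];
    [rewrite eq_sym oner_eq0 | exfalso; move: iN; rewrite N0].
have NR : 0 < N%:R :> R by rewrite ltr0n.
have : \sum_a cmod (coef x a) ^+ 2 < \sum_(a < N) (N%:R^-1 : R).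
  apply: ltr_sum; first by apply/hasP; exists (Ordinal N0); rewrite ?mem_index_enum.
  move=> a _; have := small a; rewrite -ltNge => ca.
  have N1 : N%:R^-1 <= 1 :> R by rewrite invf_le1 // ler1n.
  by have := cmod_ge0 (coef x a); nra.
by rewrite coef_parseval x1 sumr_const card_ord -(mulr_natl N%:R^-1) divff ?gt_eqF // ltxx.
Qed.

(** The constants do not depend on [e], [lam] or [x]. The second clause, that the threshold is never
    attained, prevents the index from changing as [e] varies continuously. *)
Lemma perturbed_eigenpair s d : 0 < d ->
  exists K delta sep : R, [/\ 0 < K, 0 < delta, 0 < sep &
  forall e lam x, 0 < e < delta ->
    (forall t, t != s -> d <= cmod (om t - lam)) ->
    \sum_i cmod (x i) ^+ 2 = 1 ->
    (forall i, om (blk i) * (x i + e%:C * \sum_j (W i j)%:C * x j) = lam * x i) ->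
    let dev a := cmod (lam - om s - e%:C * (om s * (w a)%:C)) in
    [/\ exists2 a, blk a = s & dev a < e * sep,
        forall a, blk a = s -> dev a != e * sep
      & forall a, blk a = s -> dev a < e * sep ->
        [/\ dev a <= K * e ^+ 2, forall b, b != a -> cmod (coef x b) <= K * e
          & N%:R^-1 <= cmod (coef x a)]]].
Proof.
move=> d0.
have [sep2 sep20 sepP] : exists2 m : R, 0 < m &
    forall p : 'I_N * 'I_N, (blk p.1 == blk p.2) && (p.1 != p.2) ->
      m <= `|w p.1 - w p.2|.
  apply: finite_lower_bound => -[a b] /= /andP[/eqP ab /eqP ne].
  by rewrite normr_gt0 subr_eq0; apply/eqP => /(winj ab).
(* Half the smallest gap: two indices of the block have deviations summing to at least
   [2 * e * sep]. *)
pose sep := sep2 / 2; have sep0 : 0 < sep by rewrite divr_gt0.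
pose K1 := M / d; have K10 : 0 <= K1 by rewrite divr_ge0 // ltW.
pose K2 := M * K1; have K20 : 0 <= K2 by rewrite mulr_ge0.
pose n : R := N%:R; have n0 : 0 <= n by rewrite ler0n.
(* The terms bound, in order, the deviation of the dominant index, the coefficients outside the
   block and the other coefficients inside it; the 1 makes [K] positive. *)
pose K := K2 * n + n * K1 + K2 / sep + 1.
have K2s : 0 <= K2 / sep by rewrite divr_ge0 // ltW.
have K2n : 0 <= K2 * n by rewrite mulr_ge0.
have nK1 : 0 <= n * K1 by rewrite mulr_ge0.
have K0 : 0 < K by rewrite /K; lra.
(* The first bound keeps coefficients outside the block below [1/N], so the dominant index lies in
   the block; the second puts its deviation below [e * sep]. *)
pose delta := Num.min ((n * (n * K1) + 1)^-1) (sep / K).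
have nnK : 0 < n * (n * K1) + 1 by rewrite ltr_wpDl // mulr_ge0.
exists K, delta, sep; split=> //; first by rewrite lt_min invr_gt0 nnK divr_gt0.
move=> e lam x /andP[e0]; rewrite lt_min => /andP[e1 e2] sep_om x1 xE dev.
have dev_sep a b : blk a = s -> blk b = s -> b != a -> e * sep2 <= dev a + dev b.
  move=> as_ bs ba; rewrite /dev (cmod_distC (lam - om s)).
  apply: le_trans (cmodD _ _).
  have -> : e%:C * (om s * (w a)%:C) - (lam - om s) +
      (lam - om s - e%:C * (om s * (w b)%:C)) = e%:C * (om s * (w a - w b)%:C).
    by rewrite rmorphB /=; ring.
  rewrite !cmodM om1 mul1r !cmodR gtr0_norm // ler_pM2l //.
  by apply: (sepP (a, b)); rewrite /= as_ bs eqxx eq_sym.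
have [a0 a0n] := large_coef x1.
have n_gt0 : 0 < n by rewrite /n ltr0n; exact: leq_ltn_trans (leq0n a0) (ltn_ord a0).
have a0s : blk a0 = s.
  apply/eqP/negPn/negP => /(off_block_coef d0 e0 sep_om x1 xE) h.
  have : n^-1 <= e * (n * K1) by exact: le_trans a0n h.
  rewrite -div1r ler_pdivrMr // => h1.
  by move: e1; rewrite -div1r ltr_pdivlMr // => h2; nra.
have dev_n a : blk a = s -> dev a * cmod (coef x a) <= e ^+ 2 * K2.
  exact: in_block_coef.
have e2K : e * K < sep by rewrite -ltr_pdivlMr.
have dev0 : dev a0 <= e ^+ 2 * (K2 * n).
  have h : dev a0 * n^-1 <= e ^+ 2 * K2.
    apply: le_trans (dev_n _ a0s); apply: ler_wpM2l => //; exact: cmod_ge0.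
  by rewrite mulrA -ler_pdivrMr.
have eK : e * (K2 * n) < sep.
  apply: le_lt_trans e2K; rewrite ler_pM2l // /K; lra.
have dev0s : dev a0 < e * sep.
  by apply: le_lt_trans dev0 _; rewrite expr2 -mulrA ltr_pM2l.
have sepE : sep2 = sep + sep by rewrite /sep; lra.
have uniq a : blk a = s -> dev a <= e * sep -> a = a0.
  move=> as_ das; apply/eqP/negPn/negP => ne.
  by have := dev_sep _ _ a0s as_ ne; rewrite sepE mulrDr; lra.
split.
- by exists a0.
- move=> a as_; apply/eqP => da; have aa0 := uniq a as_; rewrite da lexx in aa0.
  by move: dev0s; rewrite -aa0 // da ltxx.
move=> a as_ das; have aa0 := uniq a as_ (ltW das); split.
- rewrite aa0; apply: le_trans dev0 _; rewrite mulrC ler_pM2r ?exprn_gt0 //.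
  by rewrite /K; lra.
- move=> b ba; have [bs|bs] := eqVneq (blk b) s; last first.
    apply: le_trans (off_block_coef d0 e0 sep_om x1 xE bs) _.
    by rewrite mulrC ler_pM2r // -/n -/K1 /K; lra.
  (* Dividing [dev_n], of order [e ^+ 2], by this deviation leaves a coefficient of order [e]. *)
  have db : e * sep <= dev b.
    by have := dev_sep _ _ as_ bs ba; rewrite sepE mulrDr; lra.
  have h : e * sep * cmod (coef x b) <= e ^+ 2 * K2.
    by apply: le_trans (dev_n _ bs); apply: ler_wpM2r => //; exact: cmod_ge0.
  have : cmod (coef x b) <= K2 / sep * e.
    rewrite mulrAC ler_pdivlMr // -(ler_pM2l e0).
    by move: h; rewrite expr2; nra.
  move=> h1; apply: le_trans h1 _; rewrite ler_pM2r // /K; lra.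
- by rewrite aa0.
Qed.

End Perturbation.

(** * One-sided limits at 0 and sign propagation *)

Section RightLimits.
Variable R : realType.
Implicit Types (F : R -> R) (K delta : R).

Lemma cvg_at_right0_linear_bound F K delta : 0 < delta ->
  (forall e, 0 < e < delta -> `|F e| <= K * e) -> F @ 0^'+ --> (0 : R).
Proof.
move=> delta0 FK; apply/cvgr0Pnorm_le => r r0.
have K1 : 0 < `|K| + 1 by rewrite ltr_wpDl.
near=> e.
have e0 : 0 < e by near: e; exact: nbhs_right_gt.
have ed : e < delta by near: e; exact: nbhs_right_lt.
apply: le_trans (FK e _) _; first by rewrite e0 ed.
have eK : e < r / (`|K| + 1) by near: e; apply: nbhs_right_lt; rewrite divr_gt0.
rewrite ltr_pdivlMr // in eK.
by have := ler_norm K; nra.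
Unshelve. all: by end_near.
Qed.

Lemma cvg_at_right0_lt F d : 0 < d -> F @ 0^'+ --> (0 : R) ->
  exists2 delta, 0 < delta & forall e, 0 < e < delta -> F e < d.
Proof.
move=> d0 /cvgr0Pnorm_lt/(_ d d0) [r /= r0 h]; exists r => // e /andP[e0 er].
apply: le_lt_trans (ler_norm _) _; apply: h => //=.
by rewrite sub0r normrN gtr0_norm.
Qed.

(** A change of sign would produce a zero by the intermediate value theorem. *)
Lemma neg_on_interval F delta :
  (forall e, 0 < e < delta -> F x @[x --> e] --> F e) ->
  (forall e, 0 < e < delta -> F e != 0) ->
  forall e1 e2, 0 < e1 < delta -> 0 < e2 < delta -> F e1 < 0 -> F e2 < 0.
Proof.
move=> Fc Fn0 e1 e2 I1 I2 F1; rewrite ltNge; apply/negP => F2.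
have within_c a b : 0 < a < delta -> 0 < b < delta ->
    {within `[a, b], continuous F}.
  move=> /andP[a0 _] /andP[_ bd]; apply: continuous_in_subspaceT => x.
  rewrite inE /= in_itv /= => /andP[ax xb]; apply: Fc.
  by rewrite (lt_le_trans a0 ax) (le_lt_trans xb bd).
have zero a b : 0 < a < delta -> 0 < b < delta -> a <= b ->
    Num.min (F a) (F b) <= 0 <= Num.max (F a) (F b) -> False.
  move=> Ia Ib ab Fab.
  have [c] := IVT ab (within_c _ _ Ia Ib) Fab.
  rewrite in_itv /= => /andP[ac cb] Fc0.
  move/eqP: Fc0; apply/negP/Fn0.
  by case/andP: Ia Ib => a0 _ /andP[_ bd]; rewrite (lt_le_trans a0) // (le_lt_trans cb).
have [le|le] := leP e1 e2; [apply: (zero e1 e2)|apply: (zero e2 e1)] => //.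
- by rewrite ge_min le_max (ltW F1) F2 orbT.
- exact: ltW.
- by rewrite ge_min le_max (ltW F1) F2 orbT.
Qed.

End RightLimits.

(** Continuity of deviation minus threshold, as [neg_on_interval] requires; it follows from the
    reverse triangle inequality. *)
Lemma cmod_cvg_dev (R : realType) (lam : R -> R[i]) (p q : R[i]) (c e0 : R) :
  cmod (lam e - lam e0) @[e --> e0] --> (0 : R) ->
  cmod (lam e - p - e%:C * q) - e * c @[e --> e0]
    --> cmod (lam e0 - p - e0%:C * q) - e0 * c.
Proof.
move=> lamc; apply: cvgB; last by apply: cvgM; [exact: cvg_id | exact: cvg_cst].
apply/cvgrPdist_le => r r0.
have q1 : 0 < cmod q + 1 by rewrite ltr_wpDl // cmod_ge0.
have r2 : 0 < r / 2 by rewrite divr_gt0.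
near=> e.
have h1 : `|cmod (lam e - lam e0)| <= r / 2.
  by near: e; apply: (cvgr0_norm_le _ lamc) r2.
have h2 : `|e0 - e| <= r / 2 / (cmod q + 1).
  by near: e; apply: (cvgr_dist_le _ _ cvg_id); rewrite divr_gt0.
apply: le_trans (cmod_dist_dist _ _) _.
have -> : lam e0 - p - e0%:C * q - (lam e - p - e%:C * q)
    = - (lam e - lam e0) - (e0 - e)%:C * q by rewrite rmorphB /=; ring.
apply: le_trans (cmodB _ _) _; rewrite cmodN cmodM cmodR.
rewrite ger0_norm ?cmod_ge0 // in h1.
rewrite ler_pdivlMr // in h2.
have := cmod_ge0 q; have := normr_ge0 (e0 - e); nra.
Unshelve. all: by end_near.
Qed.

(** * Limits of eigenpairs and distinctness of these limits *)

Section EigenpairLimits.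
Variables (R : realType) (S N : nat) (W : 'M[R]_N) (blk : 'I_N -> 'I_S).
Local Notation C := R[i].
Variables (om : 'I_S -> C) (g : 'I_N -> 'I_N -> C) (w : 'I_N -> R).
Hypothesis Wsym : W^T = W.
Hypothesis om1 : forall s, cmod (om s) = 1.
Hypothesis om_inj : injective om.
Hypothesis gE : forall a, block_eigvec W blk (blk a) (w a)%:C (g a).
Hypothesis winj : forall a b, blk a = blk b -> w a = w b -> a = b.
Hypothesis gdot : forall a b, \sum_i (g a i)^* * g b i = (a == b)%:R.
Hypothesis gcomp : forall i j, \sum_a g a i * (g a j)^* = (i == j)%:R.
Hypothesis gg0 : forall a, \sum_i g a i * g a i != 0.

Definition perturbed_eigenpair_at (e : R) (lam : C) (x : 'I_N -> C) : Prop :=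
  \sum_i cmod (x i) ^+ 2 = 1 /\
  forall i, om (blk i) * (x i + e%:C * \sum_j (W i j)%:C * x j) = lam * x i.

(** The eigenvalue is controlled up to [e ^+ 2] and the eigenvector up to [e]. The last clause keeps
    the overlap with [g a] away from zero. *)
Definition close_to_eigvec (K e : R) (lam : C) (x : 'I_N -> C) (a : 'I_N) : Prop :=
  [/\ cmod (lam - om (blk a) - e%:C * (om (blk a) * (w a)%:C)) <= K * e ^+ 2,
      forall b, b != a -> cmod (coef g x b) <= K * e
    & N%:R^-1 <= cmod (coef g x a)].

(* For small [e] the rescaled eigenvalue shift stays within [sep] of exactly one [w a],
   never at distance [sep]; by continuity in [e] the index [a] does not change. *)
Lemma eigenpair_limit (s : 'I_S) (gam : R) (lam : R -> C) (x : R -> 'I_N -> C) :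
  0 < gam ->
  (forall e, 0 < e < gam -> perturbed_eigenpair_at e (lam e) (x e)) ->
  (forall e0, 0 < e0 < gam -> cmod (lam e - lam e0) @[e --> e0] --> (0 : R)) ->
  cmod (lam e - om s) @[e --> 0^'+] --> (0 : R) ->
  exists a K delta, [/\ blk a = s, 0 < K, 0 < delta, delta <= gam &
    forall e, 0 < e < delta -> close_to_eigvec K e (lam e) (x e) a].
Proof.
move=> gam0 xP lamc lam0.
have [d2 d20 d2P] : exists2 m : R, 0 < m &
    forall t, t != s -> m <= cmod (om t - om s).
  apply: finite_lower_bound => t ts; rewrite cmod_gt0 subr_eq0.
  by apply: contra ts => /eqP/om_inj/eqP.
(* Within half the gap of [om s], an eigenvalue is at least half the gap away from every other
   phase. *)
have d0 : 0 < d2 / 2 by rewrite divr_gt0.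
have [r1 r10 r1P] := cvg_at_right0_lt d0 lam0.
have [K [r2 [sep [K0 r20 sep0 H]]]] :=
  perturbed_eigenpair Wsym om1 gE winj gdot gcomp s d0.
pose delta := Num.min gam (Num.min r1 r2).
have delta0 : 0 < delta by rewrite !lt_min gam0 r10.
have {}H e (Ie : 0 < e < delta) := H e (lam e) (x e).
have I e : 0 < e < delta -> [/\ 0 < e < gam, 0 < e < r1 & 0 < e < r2].
  by rewrite !lt_min => /andP[-> /and3P[-> -> ->]].
have sepom e : 0 < e < delta -> forall t, t != s -> d2 / 2 <= cmod (om t - lam e).
  move=> /I[_ /r1P h _] t /d2P; have := cmodD (om t - lam e) (lam e - om s).
  by rewrite subrKA; lra.
have {}H e : 0 < e < delta -> _ := fun Ie =>
  let: And3 Ig _ I2 := I e Ie in H e Ie I2 (sepom e Ie) (xP e Ig).1 (xP e Ig).2.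
(* The index is read off at the midpoint and carried to the whole interval by [neg_on_interval]. *)
have Im : 0 < delta / 2 < delta by apply/andP; split; lra.
have [[a as_ am] _ _] := H _ Im.
exists a, K, delta; split=> //; first by rewrite ge_min lexx.
pose F e := cmod (lam e - om s - e%:C * (om s * (w a)%:C)) - e * sep.
move=> e Ie; have [_ _ /(_ a as_) He] := H e Ie.
rewrite /close_to_eigvec as_; apply: He; rewrite -subr_lt0.
apply: (@neg_on_interval _ F delta _ _ (delta / 2)) => //; last first.
- by rewrite /F subr_lt0.
- by move=> u /H[_ /(_ a as_) h _]; rewrite /F subr_eq0.
- by move=> u /I[/lamc lamu _ _]; exact: cmod_cvg_dev.
Qed.

Lemma coef_le1 x a : \sum_i cmod (x i) ^+ 2 = 1 -> cmod (coef g x a) <= 1.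
Proof. by move=> x1; apply: unit_entry_le1; rewrite coef_parseval. Qed.

(* [D^-1 f] is a left eigenvector of [D (1 + e W)]. *)
Lemma eigenvectors_bilinear_orth e lam lam' x y :
  perturbed_eigenpair_at e lam x -> perturbed_eigenpair_at e lam' y ->
  lam != lam' -> \sum_i (om (blk i))^* * (x i * y i) = 0.
Proof.
move=> [_ xE] [_ yE] ne.
(* The phases are unimodular, so their conjugates are the entries of [D^-1]. *)
have omJ s : (om s)^* * om s = 1 by rewrite -sqr_cmod om1 expr1n.
have form mu z t : (forall i, om (blk i) *
      (z i + e%:C * \sum_j (W i j)%:C * z j) = mu * z i) ->
    mu * (\sum_i (om (blk i))^* * (z i * t i)) =
    \sum_i z i * t i + e%:C * \sum_i \sum_j t i * (W i j)%:C * z j.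
  move=> zE; rewrite !mulr_sumr -big_split /=; apply: eq_bigr => i _.
  transitivity ((om (blk i))^* * (mu * z i) * t i); first by ring.
  rewrite -zE mulrA omJ mul1r mulrDl -!mulrA mulr_suml; congr (_ + _ * _).
  by apply: eq_bigr => j _; rewrite mulrC mulrA.
apply/eqP; have := form _ _ y xE; have := form _ _ x yE.
under eq_bigr do rewrite (mulrC (y _)).
set B := \sum_i (om (blk i))^* * _.
move=> Bl' Bl; have : lam * B = lam' * B.
  rewrite Bl Bl'; congr (_ + _ * _).
    by apply: eq_bigr => i _; rewrite mulrC.
  rewrite exchange_big; apply: eq_bigr => i _; apply: eq_bigr => j _.
  by rewrite (sym_entryC Wsym i j); ring.
by move/eqP; rewrite -subr_eq0 -mulrBl mulf_eq0 subr_eq0 (negPf ne).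
Qed.

Lemma close_to_eigvec_entry K e lam x a i : 0 < K -> 0 < e ->
  close_to_eigvec K e lam x a ->
  cmod (x i - coef g x a * g a i) <= N%:R * K * e.
Proof.
move=> K0 e0 [_ xb _].
have -> : x i - coef g x a * g a i = \sum_(b | b != a) coef g x b * g b i.
  by rewrite [X in X - _](coef_expand gcomp) (bigD1 a) //= addrAC subrr add0r.
apply: le_trans (cmod_sum _ _) _.
apply: (@le_trans _ _ (\sum_(b < N) K * e)); last first.
  by rewrite sumr_const card_ord -[leLHS]mulr_natl mulrA.
rewrite [leRHS](bigD1 a) //= -[leLHS]add0r; apply: lerD.
  by rewrite mulr_ge0 ?ltW.
apply: ler_sum => b ba; rewrite cmodM; apply: le_trans (xb b ba).
by rewrite ler_piMr ?cmod_ge0 // (basis_entry_le1 gdot).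
Qed.

(** Were both branches close to [g a], their vanishing pairing would be within [O(e)] of
    [c c' om_a^* G], whose modulus is at least [|G| / N^2]. *)
Lemma eigenpair_limit_inj K K' delta (lam lam' : R -> C) (x y : R -> 'I_N -> C) a :
  0 < K -> 0 < K' -> 0 < delta ->
  (forall e, 0 < e < delta ->
     [/\ perturbed_eigenpair_at e (lam e) (x e),
         perturbed_eigenpair_at e (lam' e) (y e) & lam e != lam' e]) ->
  (forall e, 0 < e < delta -> close_to_eigvec K e (lam e) (x e) a) ->
  (forall e, 0 < e < delta -> close_to_eigvec K' e (lam' e) (y e) a) ->
  False.
Proof.
move=> K0 K'0 delta0 P Px Py.
set G := \sum_i g a i * g a i; have Gpos : 0 < cmod G by rewrite cmod_gt0; exact: gg0.
pose n : R := N%:R.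
have n0 : 0 < n by rewrite /n ltr0n; exact: leq_ltn_trans (leq0n a) (ltn_ord a).
have bound e : 0 < e < delta ->
    n^-1 * n^-1 * cmod G <= n * (n * (K + K')) * e.
  move=> Ie; have /andP[e0 _] := Ie; have [xP yP ne] := P e Ie.
  have B0 := eigenvectors_bilinear_orth xP yP ne.
  have [_ _ cx] := Px e Ie; have [_ _ cy] := Py e Ie.
  have rx i := close_to_eigvec_entry i K0 e0 (Px e Ie).
  have ry i := close_to_eigvec_entry i K'0 e0 (Py e Ie).
  have c1 := coef_le1 a xP.1.
  set c := coef g (x e) a in cx rx c1; set c' := coef g (y e) a in cy ry.
  clearbody c c'.
  (* After subtracting the zero pairing, every term contains one of the residuals [x - c g_a],
     [y - c' g_a]. *)
  have key : c * c' * ((om (blk a))^* * G) =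
      \sum_i (om (blk i))^* * (- (x e i - c * g a i) * y e i
        - c * g a i * (y e i - c' * g a i)).
    rewrite -[LHS]subr0 -[in LHS]B0 -sumrN !mulr_sumr -big_split /=.
    apply: eq_bigr => i _; have [ia|ia] := eqVneq (blk i) (blk a).
      by rewrite ia; ring.
    by rewrite ((gE a).1 i ia); ring.
  apply: (@le_trans _ _ (cmod (c * c' * ((om (blk a))^* * G)))).
    rewrite !cmodM cmodJ om1 mul1r; apply: ler_wpM2r; first exact: cmod_ge0.
    by apply: ler_pM; rewrite ?invr_ge0 ?ler0n.
  rewrite key; apply: le_trans (cmod_sum _ _) _.
  have -> : n * (n * (K + K')) * e = \sum_(i < N) (n * K * e + n * K' * e).
    by rewrite sumr_const card_ord -[RHS]mulr_natl -/n; ring.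
  apply: ler_sum => i _; rewrite cmodM cmodJ om1 mul1r.
  apply: le_trans (cmodB _ _) _; rewrite !cmodM cmodN.
  have hx := rx i; have hy := ry i; have y1 := unit_entry_le1 i yP.1.
  have g1 := basis_entry_le1 gdot a i.
  have cg1 : cmod c * cmod (g a i) <= 1.
    by rewrite -[leRHS]mulr1; apply: ler_pM; rewrite ?cmod_ge0.
  apply: lerD.
    by apply: le_trans hx; rewrite ler_piMr ?cmod_ge0.
  by apply: le_trans hy; rewrite ler_piMl ?cmod_ge0.
set A := n^-1 * n^-1 * cmod G in bound.
set B := n * (n * (K + K')) in bound.
have A0 : 0 < A by rewrite !mulr_gt0 ?invr_gt0.
have B0 : 0 < B by rewrite !mulr_gt0 // addr_gt0.
have AB : 0 < A / (2 * B) by rewrite divr_gt0 // mulr_gt0.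
(* With this [e], [B * e] is at most [A / 2], contradicting [bound]. *)
pose e := Num.min (delta / 2) (A / (2 * B)).
have e0 : 0 < e by rewrite lt_min AB divr_gt0.
have e1 : e <= delta / 2 by rewrite /e ge_min lexx.
have e2 : e <= A / (2 * B) by rewrite /e ge_min lexx orbT.
have := bound e; rewrite e0 /= => /(_ ltac:(lra)).
move: e2; rewrite ler_pdivlMr ?mulr_gt0 //; nra.
Qed.

End EigenpairLimits.

(** * Projective distance, arguments and the final assembly *)

Section Assembly.
Variable R : realType.
Local Notation C := R[i].

Lemma sqr_vnorm N (v : 'cV[C]_N) : vnorm v ^+ 2 = \sum_i cmod (v i 0) ^+ 2.
Proof.
by rewrite sqr_sqrtr //; apply: sumr_ge0 => i _; rewrite exprn_ge0 ?cmod_ge0.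
Qed.

(* For unit vectors, [|v - e^(i t) u|^2 = 2 - 2 |<u, v>|] at the optimal phase [t]. *)
Lemma cpdist_le N (v u : 'cV[C]_N) (c := \sum_i (u i 0)^* * v i 0) :
  vnorm v = 1 -> vnorm u = 1 -> c != 0 ->
  0 <= cpdist v u <= Num.sqrt (2 * (1 - cmod c)).
Proof.
move=> v1 u1 c0; rewrite /cpdist; set A := (X in inf X).
have A_ge0 : lbound A 0 by move=> _ [t [_ ->]]; exact: sqrtr_ge0.
have c_gt0 : 0 < cmod c by rewrite cmod_gt0.
(* The phase of [c] turns both cross terms into the real number [|c|]. *)
have [t tI tE] : exists2 t, 0 <= t < 2 * pi & c * ((cmod c)^-1)%:C = expi t.
  by apply: expi_onto; rewrite cmodM cmodR gtr0_norm ?invr_gt0 // mulfV ?gt_eqF.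
have At : A (Num.sqrt (2 * (1 - cmod c))).
  exists t; split=> //; rewrite v1 u1 invr1 scale1r mulr1 /vnorm; congr Num.sqrt.
  apply: complexI; rewrite rmorph_sum /=; set z := expi t.
  have zz : z^* * z = 1 by rewrite -sqr_cmod cmod_expi expr1n.
  have v1C : \sum_i (v i 0)^* * v i 0 = 1.
    by under eq_bigr do rewrite -sqr_cmod; rewrite -rmorph_sum -sqr_vnorm v1 expr1n.
  have u1C : \sum_i (u i 0)^* * u i 0 = 1.
    by under eq_bigr do rewrite -sqr_cmod; rewrite -rmorph_sum -sqr_vnorm u1 expr1n.
  have cz : z^* * c = (cmod c)%:C.
    rewrite /z -tE rmorphM /= conjC_real mulrAC -sqr_cmod -rmorphM /=.
    by rewrite expr2 mulfK // gt_eqF.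
  have cz' : z * c^* = (cmod c)%:C.
    by rewrite -[RHS]conjC_real -cz rmorphM /= conjCK.
  under eq_bigr => i _.
    rewrite sqr_cmod !mxE (_ : _ * _ = (v i 0)^* * v i 0
      - z^* * ((u i 0)^* * v i 0) - z * ((u i 0)^* * v i 0)^*
      + z^* * z * ((u i 0)^* * u i 0)).
      over.
    by rewrite rmorphB !rmorphM /= conjCK; ring.
  rewrite !big_split /= !sumrN -!mulr_sumr -rmorph_sum -/c v1C u1C cz cz' zz.
  by rewrite rmorphM rmorphB /=; ring.
apply/andP; split; first by apply: lb_le_inf => //; exists (Num.sqrt (2 * (1 - cmod c))).
by apply: ge_inf => //; exists 0.
Qed.

(** A negative factor turns the phase by [pi]: [th1] and [th2 + pi] both have exponential [- om]. *)
Lemma expi_neg_arg (om : C) (w th1 th2 : R) : w < 0 -> cmod om = 1 ->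
  is_arg (om * w%:C) th1 -> is_arg om th2 ->
  exists m : int, th1 = th2 + pi + 2 * pi * m%:~R.
Proof.
move=> w0 om1; rewrite /is_arg om1 mul1r cmodM om1 mul1r cmodR ltr0_norm //.
move=> h1 h2.
have omE : expi th1 = - om.
  have wn : w%:C != 0 :> C by rewrite (inj_eq (@complexI R)) lt_eqF.
  apply: (mulfI wn); rewrite mulrN [RHS](_ : _ = - (om * w%:C)); last by ring.
  by rewrite h1 rmorphN mulNr opprK.
have expi_pi : expi (th2 + pi) = - om.
  by rewrite h2 /expi cosDpi sinDpi.
have [|m mE] := @expi_eq1 R (th1 - (th2 + pi)).
  have om0 : - om != 0 by rewrite oppr_eq0 -cmod_gt0 om1 ltr01.
  by apply: (mulIf om0); rewrite -{1}expi_pi -expiD subrK omE mul1r.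
by exists m; rewrite -mE; ring.
Qed.

Lemma DmatE S N (L : 'I_S -> nat) (blk : 'I_N -> 'I_S) k (beta : 'I_S -> R) :
  (forall s i, inblock L s i = (blk i == s)) ->
  Dmat N L k beta = diag_mx (\row_i ephase k%:R (beta (blk i))).
Proof.
move=> blkE; apply/matrixP => i j; rewrite !mxE; case: eqVneq => [_|//].
by rewrite mulr1n (big_pred1 (blk i)) // => s; rewrite blkE eq_sym.
Qed.

End Assembly.

Unset Implicit Arguments.
Set Strict Implicit.
Set Printing Implicit Defensive.
Local Open Scope complex_scope.

Theorem theorem4p2 (R : realType) (S N : nat) (L : 'I_S -> nat) (W : 'M[R]_N)
  (k : nat) (beta : 'I_S -> R) (gam : R)
  (f : R -> 'I_N -> 'cV[R[i]]_N) (lam : R -> 'I_N -> R[i]) :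
  (1 < S)%N -> (S <= N)%N -> bandwidth N L -> admissible L W ->
  (0 < k)%N -> inGamma beta -> 0 < gam ->
  (forall e : R, 0 < e < gam ->
     has_distinct_eigs (Dmat N L k beta *m Weps W e)) ->
  (forall e : R, 0 < e < gam ->
     [/\ injective (lam e),
         forall l, vnorm (f e l) = 1,
         forall l, (Dmat N L k beta *m Weps W e) *m f e l = lam e l *: f e l
       & (\matrix_(i < N, l < N) f e l i 0) \in unitmx]) ->
  (forall l : 'I_N, {in `]0, gam[, forall e0 : R,
     (fun e : R => cmod (lam e l - lam e0 l)) @ e0 --> (0 : R)}) ->
  (forall (s : 'I_S) (l : 'I_N), inblock L s l ->
     (fun e : R => cmod (lam e l - ephase k%:R (beta s))) @ 0^'+ --> (0 : R)) ->
  exists (g : 'I_N -> 'cV[R[i]]_N) (mu : 'I_N -> R[i]),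
    [/\ (forall a b : 'I_N, cdot (g a) (g b) = (a == b)%:R),
        (forall l : 'I_N, (Dmat N L k beta *m hatW L W) *m g l = mu l *: g l),
        (forall l : 'I_N,
           (fun e : R => cpdist (f e l) (g l)) @ 0^'+ --> (0 : R))
      & (forall (s : 'I_S) (l : 'I_N), inblock L s l ->
           (fun e : R =>
              cmod (lam e l - ephase k%:R (beta s) - e%:C * mu l) / e)
             @ 0^'+ --> (0 : R)
           /\ (mu l != 0 ->
               forall th1 th2 : R, is_arg (mu l) th1 ->
                 is_arg (ephase k%:R (beta s)) th2 ->
                 exists m : int, th1 = th2 + pi + 2 * pi * m%:~R))].
Proof.
move=> _ _ [_ Lsum] [Wsym [W_ge0 [W_row [_ eigsW]]]] k0 betaG gam0 _ fP lamc lam0.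
have [blk blkE] := block_indexP Lsum.
pose om s := ephase k%:R (beta s).
have om1 s : cmod (om s) = 1 by exact: cmod_expi.
have om_inj : injective om.
  move=> s t st; apply/eqP/negPn/negP => ne.
  have kn0 : k%:Z != 0 by rewrite -lt0n.
  by have := betaG _ _ _ kn0 ne; rewrite -[ephase _ _]/(om s) st eqxx.
have [g0 [w0 [g0supp g0n g0E w0inj]]] := block_eigenvectors Lsum blkE eigsW.
(* Symmetry of [W] turns left eigenvectors of the blocks into right ones. *)
have g0B a : block_eigvec W blk (blk a) (w0 a) (g0 a).
  split=> [i|i ia]; first exact: g0supp.
  rewrite -g0E //; apply: eq_bigr => j _; rewrite mulrC.
  by rewrite (sym_entryC Wsym i j).
have [g [w [gE w_le0 winj [gdot gcomp gg0]]]] :=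
  block_eigenbasis Wsym W_ge0 W_row g0B g0n w0inj.
have xP e l : 0 < e < gam ->
    perturbed_eigenpair_at W blk om e (lam e l) (fun i => f e l i 0).
  move=> /fP[_ f1 fE _]; split; first by rewrite -sqr_vnorm f1 expr1n.
  move=> i; have /matrixP/(_ i 0) := fE l.
  rewrite (DmatE k beta blkE) -mulmxA mul_diag_mx /Weps mulmxDl mul1mx -scalemxAl.
  rewrite !mxE => <-; congr (_ * (_ + _ * _)).
  by apply: eq_bigr => j _; rewrite !mxE.
have lim l : exists p : 'I_N * R * R, [/\ blk p.1.1 = blk l, 0 < p.1.2, 0 < p.2,
    p.2 <= gam & forall e, 0 < e < p.2 ->
    close_to_eigvec blk om g w p.1.2 e (lam e l) (fun i => f e l i 0) p.1.1].
  have [|||a [K [delta H]]] := eigenpair_limit Wsym om1 om_inj gE winj gdot gcomp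
    (s := blk l) (lam := lam ^~ l) (x := fun e i => f e l i 0) gam0.
  - by move=> e; exact: xP.
  - by move=> e0 Ie; apply: lamc; rewrite in_itv.
  - by apply: lam0; rewrite blkE.
  by exists (a, K, delta).
have {lim} [p pP] := choice lim.
(* [sig l] is the index of the basis vector to which branch [l] converges; its injectivity makes the
   relabelled family orthonormal. *)
pose sig l := (p l).1.1; pose K l := (p l).1.2; pose delta l := (p l).2.
have {pP} pP l : [/\ blk (sig l) = blk l, 0 < K l, 0 < delta l, delta l <= gam &
    forall e, 0 < e < delta l ->
    close_to_eigvec blk om g w (K l) e (lam e l) (fun i => f e l i 0) (sig l)].
  exact: pP.
have sig_inj : injective sig.
  move=> l l' ll'; apply/eqP/negPn/negP => ne.
  have [_ K0 d0 dg H] := pP l; have [_ K0' d0' _ H'] := pP l'.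
  rewrite -ll' in H'.
  apply: (eigenpair_limit_inj Wsym om1 gE gdot gcomp gg0
    (delta := Num.min (delta l) (delta l')) (lam := lam ^~ l) (lam' := lam ^~ l')
    (x := fun e i => f e l i 0) (y := fun e i => f e l' i 0)
    K0 K0'); first by rewrite lt_min d0.
  - move=> e; rewrite lt_min => /and3P[e0 e1 _].
    have Ie : 0 < e < gam by rewrite e0 (lt_le_trans e1).
    split; [exact: xP|exact: xP|].
    by have [/inj_eq -> _ _ _] := fP e Ie.
  - by move=> e; rewrite lt_min => /and3P[e0 e1 _]; apply: H; rewrite e0.
  - by move=> e; rewrite lt_min => /and3P[e0 _ e1]; apply: H'; rewrite e0.
exists (fun l => \col_i g (sig l) i), (fun l => om (blk l) * (w (sig l))%:C); split.
- move=> a b; rewrite -(inj_eq sig_inj) -gdot.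
  by apply: eq_bigr => i _; rewrite !mxE.
- move=> l; have [bl _ _ _ _] := pP l; have [g_supp g_eig] := gE (sig l).
  apply/matrixP => i j; rewrite (DmatE k beta blkE) -mulmxA mul_diag_mx !mxE.
  (* Outside the block of [l] both sides vanish, since [hatW] couples only indices of the same
     block. *)
  have [il|il] := eqVneq (blk i) (blk l); last first.
    rewrite (g_supp i) ?bl // mulr0 big1 ?mulr0 // => m _; rewrite !mxE.
    have [ml|ml] := eqVneq (blk m) (blk l); last by rewrite g_supp ?mulr0 ?bl.
    case: existsP => [[s]|]; last by rewrite mul0r.
    by rewrite !blkE ml => /andP[/eqP <- /eqP im]; rewrite im eqxx in il.
  rewrite il -/(om _) -mulrA; congr (_ * _); rewrite -g_eig ?bl //.
  rewrite (bigID (fun m => blk m == blk l)) /= [X in _ + X]big1 ?addr0 => [|m ml].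
    apply: eq_bigr => m ml; rewrite !mxE; case: existsP => // -[].
    by exists (blk l); rewrite !blkE il ml eqxx.
  by rewrite !mxE g_supp ?mulr0 ?bl.
- move=> l; have [bl K0 d0 dg H] := pP l.
  have n0 : 0 < N%:R :> R by rewrite ltr0n; exact: leq_ltn_trans (leq0n l) (ltn_ord l).
  (* By Parseval, [1 - |c|^2] is at most [N (K e)^2], and [1 - |c| <= 1 - |c|^2] because [|c| <= 1];
     insert this in [cpdist_le]. *)
  apply: (@cvg_at_right0_linear_bound _ _ (Num.sqrt (2 * N%:R) * K l) (delta l)) => //.
  move=> e Ie; have /andP[e0 ed] := Ie; have [_ cb ca] := H e Ie.
  have Ig : 0 < e < gam by rewrite e0 (lt_le_trans ed).
  have [_ f1 _ _] := fP e Ig; have [x1 _] := xP e l Ig.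
  set c := coef g (fun i => f e l i 0) in cb ca.
  have cE : \sum_i ((\col_i g (sig l) i) i 0)^* * f e l i 0 = c (sig l).
    by apply: eq_bigr => i _; rewrite mxE.
  have c0 : 0 < cmod (c (sig l)) by apply: lt_le_trans ca; rewrite invr_gt0.
  have u1 : vnorm (\col_i g (sig l) i) = 1.
    apply/eqP; rewrite -(@eqrXn2 _ 2) ?sqrtr_ge0 // expr1n sqr_vnorm; apply/eqP.
    apply: complexI; transitivity ((sig l == sig l)%:R : R[i]); last by rewrite eqxx.
    rewrite rmorph_sum -gdot /=.
    by apply: eq_bigr => i _; rewrite sqr_cmod mxE.
  have := cpdist_le (f1 l) u1; rewrite cE -cmod_gt0 => /(_ c0)/andP[dist0 distle].
  rewrite ger0_norm //; apply: le_trans distle _.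
  have -> : Num.sqrt (2 * N%:R) * K l * e = Num.sqrt (2 * N%:R * (K l * e) ^+ 2).
    rewrite [RHS]sqrtrM ?mulr_ge0 // sqrtr_sqr ger0_norm ?mulrA //.
    by rewrite mulr_ge0 ?ltW.
  rewrite ler_sqrt; last by apply: mulr_ge0; [apply: mulr_ge0 | apply: sqr_ge0].
  rewrite -mulrA ler_pM2l //.
  have c1 := coef_le1 gcomp (sig l) x1; rewrite -/c in c1.
  have := coef_parseval gcomp (fun i => f e l i 0).
  rewrite x1 -/c (bigD1 (sig l)) //= => par.
  have rest : \sum_(b | b != sig l) cmod (c b) ^+ 2 <= N%:R * (K l * e) ^+ 2.
    apply: (@le_trans _ _ (\sum_(b < N) (K l * e) ^+ 2)); last first.
      by rewrite sumr_const card_ord -[leLHS]mulr_natl.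
    rewrite [leRHS](bigD1 (sig l)) //= -[leLHS]add0r.
    apply: lerD; first exact: sqr_ge0.
    apply: ler_sum => b /cb h; rewrite ler_pXn2r // nnegrE ?cmod_ge0 //.
    by rewrite mulr_ge0 ?ltW.
  nra.
- move=> s l; rewrite blkE => /eqP sl; have [bl K0 d0 dg H] := pP l; split.
    (* The deviation is at most [K e^2], so its quotient by [e] is at most [K e]. *)
    apply: (@cvg_at_right0_linear_bound _ _ (K l) (delta l)) => // e Ie.
    have /andP[e0 _] := Ie; have [dev _ _] := H e Ie.
    rewrite ger0_norm; last by rewrite divr_ge0 ?cmod_ge0 ?ltW.
    by rewrite ler_pdivrMr // -mulrA -expr2 -sl -[ephase _ _]/(om _) -bl.
  move=> mu0 th1 th2; rewrite -sl -[ephase _ _]/(om _).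
  apply: expi_neg_arg => //; rewrite lt_neqAle w_le0 andbT.
  by apply: contra mu0 => /eqP ->; rewrite rmorph0 mulr0.
Qed.
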